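(* Let $H$ be a complex Hilbert space and let $(x_i)_{i\in I}$ be a frame for $H$, with $I$ a countable index set. Then $(x_i)_{i\in I}$ is equivalent to a frame $(y_i)_{i\in I}$ for $H$ for which there exist a Hilbert space $K$ containing $H$ as a closed subspace (with the inherited inner product) and two orthonormal bases $(f_i)_{i\in I}$, $(g_i)_{i\in I}$ for $K$ such that $y_i=\tfrac12(f_i+g_i)$ for all $i\in I$.
   Context: A family $(x_i)_{i\in I}$ in a Hilbert space $H$ is a frame for $H$ if there are constants $0<A\le B$ such that $A\|x\|^2\le\sum_{i\in I}|\langle x,x_i\rangle|^2\le B\|x\|^2$ for all $x\in H$. Two frames $(x_i)_{i\in I}$ and $(y_i)_{i\in I}$ for $H$ are equivalent if there is a bounded invertible operator $L:H\to H$ (with bounded inverse) such that $Lx_i=y_i$ for all $i\in I$. *)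

(* Defs.v *)
From HB Require Import structures.
From mathcomp Require Import all_boot all_order all_algebra.
From mathcomp Require Import all_classical all_reals all_analysis.
From mathcomp Require Import complex.

Set Implicit Arguments.
Unset Strict Implicit.
Unset Printing Implicit Defensive.

Import Order.TTheory GRing.Theory Num.Theory.
Import numFieldNormedType.Exports.

Local Open Scope classical_set_scope.
Local Open Scope ring_scope.

(* [inner] is linear in its first argument and conjugate-linear in its
   second.  The norm, topology and completeness are those of the underlying
   [completeNormedModType]; [inner_normE] forces the norm to be the one induced
   by [inner]. *)
HB.mixin Record CompleteNormedModule_isHilbert (R : realType) H
    & CompleteNormedModule R[i] H := {
  inner : {dot H for (@Num.conj R[i])} ;
  inner_normE : forall x : H, inner x x = `|x| ^+ 2
}.

#[short(type="hilbertType")]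
HB.structure Definition Hilbert (R : realType) :=
  {H of CompleteNormedModule_isHilbert R H & CompleteNormedModule R[i] H}.

(* In a normed module over R[i] the library norm lives in R[i] (and is a
   nonnegative real there); [rnorm] is the same norm, read in R. *)
Definition rnorm (R : realType) (V : normedModType R[i]) (x : V) : R :=
  complex.Re `|x|.

Section HilbertFamilies.
Variables (R : realType) (H : hilbertType R).

(* The sum is an unordered sum of nonnegative terms, in [0, +oo]. *)
Definition is_frame (I : choiceType) (x : I -> H) : Prop :=
  exists A B : R, [/\ 0 < A, A <= B & forall v : H,
    ((A * rnorm v ^+ 2)%:E
       <= \esum_(i in [set: I]) (rnorm (inner v (x i) : R[i]^o) ^+ 2)%:E)%E /\
    (\esum_(i in [set: I]) (rnorm (inner v (x i) : R[i]^o) ^+ 2)%:E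
       <= (B * rnorm v ^+ 2)%:E)%E].

Definition bounded_operator (L : H -> H) : Prop :=
  exists M : R, forall v : H, rnorm (L v) <= M * rnorm v.

Definition equivalent_families (I : Type) (x y : I -> H) : Prop :=
  exists L L' : {linear H -> H},
    [/\ bounded_operator L, bounded_operator L', cancel L L', cancel L' L
      & forall i, L (x i) = y i].

Definition lin_span (I : Type) (f : I -> H) : set H :=
  [set v | exists (s : seq I) (c : I -> R[i]), v = \sum_(i <- s) c i *: f i].

Definition orthonormal_basis (I : eqType) (f : I -> H) : Prop :=
  (forall i j, inner (f i) (f j) = (i == j)%:R) /\
  closure (lin_span f) = [set: H].

End HilbertFamilies.

(* H is a closed subspace of K, with the inherited inner product, through J. *)
Definition closed_subspace_embedding (R : realType) (H K : hilbertType R)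
    (J : {linear H -> K}) : Prop :=
  (forall u v : H, inner (J u) (J v) = inner u v) /\ closed (range J).

(* Main.v *)
Require Import Defs.
From HB Require Import structures.
From mathcomp Require Import all_boot all_order all_algebra.
From mathcomp Require Import all_classical all_reals all_analysis.
From mathcomp Require Import finmap complex ring lra.

(** Let C : H -> l2(I) be the analysis operator v |-> (<v, x_i>)_i of the frame
and S = C* C its frame operator. The frame inequalities say that
A <= S <= B, so S has a bounded inverse square root L, self-adjoint and
invertible ([inverse_square_root]). The family y_i = L x_i is equivalent to
x, and its analysis operator is J = C L, for which
<J u, J v> = <S L u, L v> = <u, v>. Thus J is an isometry of H into
K = l2(I), and y is a frame with both bounds equal to 1.

Let (e_i) be the standard orthonormal basis of K. Pairing with J v shows
J* e_i = y_i, whence J y_i = P e_i, where P = J J* is the orthogonal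
projection onto the closed subspace J H. The point is that a projection is the
average of two unitaries, P = (1 + U) / 2 with U = 2 P - 1 the reflection
through J H ([reflection_exists]). Hence J y_i = (e_i + U e_i) / 2, and both
(e_i) and (U e_i) are orthonormal bases of K.

Adjoints come from the Riesz representation theorem ([riesz],
[adjoint_exists]). The square root of S / B is found as 1 - Y, where Y is
the limit of a quadratic iteration that converges geometrically since
1 - S / B is a strict contraction ([contraction_square_root]); 1 - Y is then
inverted by a Neumann iteration ([neumann_inverse]). The space l2(I) is
built on unordered sums: the inner product is defined through sums of signed
families ([rsum]), and completeness is a Fatou argument along an arbitrary
Cauchy filter ([l2_complete]). *)

Set Implicit Arguments.
Unset Strict Implicit.
Unset Printing Implicit Defensive.

Import Order.TTheory GRing.Theory Num.Theory.
Import numFieldNormedType.Exports.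

Local Open Scope classical_set_scope.
Local Open Scope ring_scope.

Local Notation "x %:C" := (real_complex _ x) : ring_scope.

(** * Complex scalars and the real-valued norm *)

Section ComplexScalars.
Variable R : realType.
Implicit Types z w : R[i].

Lemma ReD z w : complex.Re (z + w) = complex.Re z + complex.Re w.
Proof. by case: z w => [a b] [c d]. Qed.

Lemma ReN z : complex.Re (- z) = - complex.Re z.
Proof. by case: z. Qed.

Lemma ReB z w : complex.Re (z - w) = complex.Re z - complex.Re w.
Proof. by rewrite ReD ReN. Qed.

Lemma ReCM (t : R) z : complex.Re (t%:C * z) = t * complex.Re z.
Proof. by case: z => a b /=; rewrite mul0r subr0. Qed.

Lemma ReJ z : complex.Re z^* = complex.Re z.
Proof. by case: z. Qed.

(** Lets an identity between complex-linear functions be checked on real parts only. *)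
Lemma ImE_Re z : complex.Im z = complex.Re (- 'i%C * z).
Proof. by case: z => a b /=; ring. Qed.

Lemma conjcM z w : (z * w)^* = z^* * w^*.
Proof. exact: rmorphM. Qed.

Lemma conjcN z : (- z)^* = - z^*.
Proof. exact: rmorphN. Qed.

Lemma conj_realC (t : R) : (t%:C)^* = t%:C.
Proof. exact: conjc_real. Qed.

Lemma rnormzE z : rnorm (z : R[i]^o) ^+ 2 = complex.Re z ^+ 2 + complex.Im z ^+ 2.
Proof.
by rewrite /rnorm normc_def /= sqr_sqrtr // addr_ge0 ?sqr_ge0.
Qed.

Lemma rnormz_conj z : (rnorm (z : R[i]^o) ^+ 2)%:C = z * z^*.
Proof. by rewrite rnormzE add_Re2_Im2 sqr_normc. Qed.

Lemma rnormzJ z : rnorm (z^* : R[i]^o) = rnorm (z : R[i]^o).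
Proof. by rewrite /rnorm normcJ. Qed.

End ComplexScalars.

Section RealNorm.
Variables (R : realType) (V : normedModType R[i]).
Implicit Types (u v : V) (e : R).

Lemma rnormE u : (rnorm u)%:C = `|u|.
Proof. by rewrite /rnorm RRe_real ?normr_real. Qed.

Lemma rnorm_ge0 u : 0 <= rnorm u.
Proof. by rewrite -ler0c rnormE. Qed.

Lemma rnorm_eq0 u : (rnorm u == 0) = (u == 0).
Proof. by rewrite -(inj_eq (@complexI _)) rnormE normr_eq0. Qed.

Lemma rnorm0 : rnorm (0 : V) = 0.
Proof. by apply/eqP; rewrite rnorm_eq0. Qed.

Lemma ler_rnormD u v : rnorm (u + v) <= rnorm u + rnorm v.
Proof. by rewrite -lecR rmorphD /= !rnormE ler_normD. Qed.

Lemma rnormN u : rnorm (- u) = rnorm u.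
Proof. by rewrite /rnorm normrN. Qed.

Lemma rnorm_distC u v : rnorm (u - v) = rnorm (v - u).
Proof. by rewrite /rnorm distrC. Qed.

Lemma rnormZ (a : R[i]) u : rnorm (a *: u) = rnorm (a : R[i]^o) * rnorm u.
Proof. by apply: complexI; rewrite rmorphM /= !rnormE normrZ. Qed.

Lemma rnorm_realC (t : R) : rnorm (t%:C : R[i]^o) = `|t|.
Proof. by rewrite /rnorm normc_def /= expr0n addr0 sqrtr_sqr. Qed.

Lemma rnormCZ (t : R) u : rnorm (t%:C *: u) = `|t| * rnorm u.
Proof.
by rewrite rnormZ rnorm_realC.
Qed.

Lemma ler_rnorm_dist u v : `|rnorm u - rnorm v| <= rnorm (u - v).
Proof.
have := ler_rnormD (u - v) v; have := ler_rnormD (v - u) u.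
by rewrite !subrK (rnorm_distC v) ler_norml => ? ?; apply/andP; split; lra.
Qed.

(** A radius in R[i] is positive only if it is real, so convergence can be
tested with real radii; every estimate below is made in R. *)
Lemma cvg_rnormP T (F : set_system T) {FF : Filter F} (f : T -> V) l :
  f @ F --> l <-> forall e, 0 < e -> \forall x \near F, rnorm (f x - l) <= e.
Proof.
split=> [/cvgrPdist_le fl e e0|fl].
  have := fl e%:C; rewrite ltcR => /(_ e0); apply: filterS => x.
  by rewrite -rnormE lecR rnorm_distC.
apply/cvgrPdist_le => e e0.
have eE : e = (complex.Re e)%:C by rewrite RRe_real // gtr0_real.
have /fl : 0 < complex.Re e by rewrite -ltcR -eE.
by apply: filterS => x; rewrite rnorm_distC -lecR rnormE -eE.
Qed.

Lemma cvg_rnorm_dist T (F : set_system T) {FF : Filter F} (f : T -> V) l :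
  f @ F --> l <-> (fun x => rnorm (f x - l)) @ F --> (0 : R).
Proof.
rewrite cvg_rnormP; split=> [fl|/cvgrPdist_le fl e /fl].
  apply/cvgrPdist_le => e /fl; apply: filterS => x.
  by rewrite sub0r normrN ger0_norm // rnorm_ge0.
by apply: filterS => x; rewrite sub0r normrN ger0_norm // rnorm_ge0.
Qed.

Lemma cvg_rnorm T (F : set_system T) {FF : Filter F} (f : T -> V) l :
  f @ F --> l -> (fun x => rnorm (f x)) @ F --> rnorm l.
Proof.
move=> /cvg_rnormP fl; apply/cvgrPdist_le => e /fl; apply: filterS => x.
by rewrite distrC; apply: le_trans (ler_rnorm_dist _ _).
Qed.

Lemma rnorm_limit_le (u : nat -> V) l (v : nat -> R) m :
  u @ \oo --> l -> v @ \oo --> m -> (forall n, rnorm (u n) <= v n) -> rnorm l <= m.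
Proof.
move=> /cvg_rnorm ul vm uv.
rewrite -(cvg_lim (@Rhausdorff R) ul) -(cvg_lim (@Rhausdorff R) vm).
apply: ler_lim; [| | exact: nearW].
  by apply/cvg_ex; exists (rnorm l).
by apply/cvg_ex; exists m.
Qed.

End RealNorm.

Lemma ler_Re_rnorm (R : realType) (z : R[i]) : `|complex.Re z| <= rnorm (z : R[i]^o).
Proof.
rewrite -ler_sqr ?nnegrE ?rnorm_ge0 // real_normK ?num_real //.
by rewrite rnormzE lerDl sqr_ge0.
Qed.

Lemma ler_Im_rnorm (R : realType) (z : R[i]) : `|complex.Im z| <= rnorm (z : R[i]^o).
Proof.
rewrite -ler_sqr ?nnegrE ?rnorm_ge0 // real_normK ?num_real //.
by rewrite rnormzE lerDr sqr_ge0.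
Qed.

Section Completeness.
Variables (R : realType) (V : completeNormedModType R[i]).

Lemma rnorm_cauchy_cvg (u : nat -> V) :
  (forall e : R, 0 < e -> exists N, forall m n, (N <= m)%N -> (N <= n)%N ->
     rnorm (u m - u n) <= e) ->
  exists l : V, u @ \oo --> l.
Proof.
move=> hu; suff /cvg_ex[l ul] : cvg (u @ \oo) by exists l.
apply: cauchy_cvg; apply: cauchy_exP => e e0.
have eE : e = (complex.Re e)%:C by rewrite RRe_real // gtr0_real.
have e20 : 0 < complex.Re e / 2 by rewrite divr_gt0 // -ltcR -eE.
have [N hN] := hu _ e20.
exists (u N); exists N => // n /= Nn.
rewrite -ball_normE /= eE -rnormE ltcR.
apply: le_lt_trans (hN N n (leqnn _) Nn) _.
by rewrite ltr_pdivrMr // ltr_pMr ?ltr1n // -ltcR -eE.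
Qed.

(** Both fixed-point iterations of the proof, for the square root and for the
Neumann series, converge by this criterion. *)
Lemma geometric_steps_cvg (u : nat -> V) (c q : R) : 0 <= q < 1 ->
  (forall n, rnorm (u n.+1 - u n) <= c * q ^+ n) -> exists l : V, u @ \oo --> l.
Proof.
move=> /andP[q0 q1] hu.
have c0 : 0 <= c.
  by have := le_trans (rnorm_ge0 _) (hu 0%N); rewrite expr0 mulr1.
have dist m k : rnorm (u (m + k)%N - u m) <= c * q ^+ m / (1 - q).
  (* The sharper bound, with the finite geometric sum, is the inductive one. *)
  suff : rnorm (u (m + k)%N - u m) <= c * q ^+ m / (1 - q) * (1 - q ^+ k).
    move=> /le_trans; apply; rewrite ler_piMr //.
      by rewrite divr_ge0 ?mulr_ge0 ?exprn_ge0 // subr_ge0 ltW.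
    by rewrite lerBlDr lerDl exprn_ge0.
  elim: k => [|k IH]; first by rewrite addn0 subrr rnorm0 expr0 subrr mulr0.
  rewrite addnS.
  have -> : u (m + k).+1 - u m =
      (u (m + k).+1 - u (m + k)%N) + (u (m + k)%N - u m).
    by rewrite addrA subrK.
  apply: le_trans (ler_rnormD _ _) _; apply: le_trans (lerD (hu _) IH) _.
  rewrite exprD exprS le_eqVlt; apply/orP; left; apply/eqP; field.
  by rewrite subr_eq0 gt_eqF.
have qcvg : (fun m => c * q ^+ m / (1 - q)) @ \oo --> (0 : R).
  rewrite -(mul0r (1 - q)^-1); apply: cvgM; last exact: cvg_cst.
  rewrite -(mulr0 c); apply: cvgM; first exact: cvg_cst.
  by apply: cvg_expr; rewrite ger0_norm.
apply: rnorm_cauchy_cvg => e e0.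
have e20 : 0 < e / 2 by rewrite divr_gt0.
have /cvgrPdist_le /(_ _ e20) [N _ hN] := qcvg.
have close n : (N <= n)%N -> rnorm (u n - u N) <= e / 2.
  move=> Nn; rewrite -(subnKC Nn); apply: le_trans (dist _ _) _.
  by have := hN N (leqnn _); rewrite /= sub0r normrN; apply: le_trans; exact: ler_norm.
exists N => m n Nm Nn.
have -> : u m - u n = (u m - u N) + (u N - u n) by rewrite addrA subrK.
apply: le_trans (ler_rnormD _ _) _; rewrite (rnorm_distC (u N)).
by apply: le_trans (lerD (close _ Nm) (close _ Nn)) _; rewrite -splitr.
Qed.

End Completeness.

(** * Hilbert spaces: Cauchy-Schwarz, Riesz representation, adjoints *)

Section PositiveForms.
Variables (R : realType) (V : lmodType R[i]) (B : V -> V -> R[i]).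
Hypothesis Blin : forall a u v w, B (a *: u + v) w = a * B u w + B v w.
Hypothesis Bherm : forall u v, B u v = (B v u)^*.
Hypothesis Bpos : forall u, 0 <= B u u.

(** The form may be degenerate: besides inner products, this is applied to
<X u, v> for a positive operator X, where it turns a bound on the quadratic
form into a bound on the operator norm. *)
Lemma cauchy_schwarz u v :
  rnorm (B u v : R[i]^o) ^+ 2 <= complex.Re (B u u) * complex.Re (B v v).
Proof.
set b := B u v; set p := complex.Re _; set r := complex.Re _.
have := rnormz_conj b; set beta := rnorm _ ^+ 2.
have b0 : 0 <= beta by rewrite sqr_ge0.
move: beta b0 => beta b0 betaE.
have ReE (z : R[i]) : 0 <= z -> z = (complex.Re z)%:C by move=> /ger0_real/RRe_real.
(* This is the form at u - t b v, where the phase of b makes the cross terms real. *)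
have quad (t : R) : 0 <= p - (t * beta + t * beta) + t * t * beta * r.
  have Blin' a x y w : B w (a *: x + y) = a^* * B w x + B w y.
    by rewrite Bherm Blin rmorphD rmorphM /= -!Bherm.
  have aJ : (- (t%:C * b))^* = - (t%:C * b^*) by rewrite conjcN conjcM conj_realC.
  have := Bpos ((- (t%:C * b)) *: v + u).
  rewrite Blin !Blin' aJ (ReE _ (Bpos u)) (ReE _ (Bpos v)) (Bherm v u) -/b -/p -/r.
  suff -> : - (t%:C * b) * (- (t%:C * b^*) * r%:C + b^*) + (- (t%:C * b^*) * b + p%:C)
      = (p - (t * beta + t * beta) + t * t * beta * r)%:C by rewrite ler0c.
  rewrite !rmorphD rmorphN !rmorphD !rmorphM /= betaE; ring.
have r0 : 0 <= r by rewrite -ler0c -ReE.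
case: (eqVneq r 0) => [rE|rn0].
  rewrite rE mulr0 leNgt; apply/negP => bpos.
  (* With r = 0 the quadratic is affine in t; this t makes it equal to -1. *)
  have := quad ((p + 1) / (2 * beta)); rewrite rE mulr0 addr0.
  have -> : (p + 1) / (2 * beta) * beta = (p + 1) / 2 by field; rewrite gt_eqF.
  lra.
have rpos : 0 < r by rewrite lt_def rn0.
have := quad r^-1.
have -> : p - (r^-1 * beta + r^-1 * beta) + r^-1 * r^-1 * beta * r
    = p - beta / r by field.
by rewrite subr_ge0 ler_pdivrMr.
Qed.

End PositiveForms.

Lemma linear_function_bundle (R : nzRingType) (U V : lmodType R) (f : U -> V) :
  linear f -> exists g : {linear U -> V}, g =1 f.
Proof.
move=> flin; have fL := GRing.isLinear.Build R U V *:%R f flin.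
by exists (HB.pack f fL : {linear U -> V}).
Qed.

Lemma cvg_rnorm_lipschitz (R : realType) (V W : normedModType R[i])
    (k : R) (u : nat -> V) (v : V) (f : nat -> W) (l : W) :
  u @ \oo --> v -> (forall n, rnorm (f n - l) <= k * rnorm (u n - v)) ->
  f @ \oo --> l.
Proof.
move=> /cvg_rnorm_dist uv fl; apply/cvg_rnorm_dist.
apply: (@squeeze_cvgr _ _ _ _ (cst 0) (fun n => k * rnorm (u n - v))).
- by apply: nearW => n; rewrite rnorm_ge0 fl.
- exact: cvg_cst.
- by rewrite -(mulr0 k); apply: cvgM => //; exact: cvg_cst.
Qed.

(** Identities between approximants pass to the limit operators in this form. *)
Lemma limit_unique (R : realType) (V : normedModType R[i]) (u v : nat -> V) (l m : V) :
  (forall n, u n = v n) -> u @ \oo --> l -> v @ \oo --> m -> l = m.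
Proof. by move=> /funext ->; exact: (cvg_unique (@norm_hausdorff _ V)). Qed.

Section InnerProduct.
Variables (R : realType) (H : hilbertType R).
Implicit Types (u v w : H).

Lemma inner_rnorm u : inner u u = (rnorm u ^+ 2)%:C.
Proof. by rewrite inner_normE -rnormE rmorphXn. Qed.

Lemma innerC u v : inner u v = (inner v u)^*.
Proof. by rewrite hermC expr0 mul1r. Qed.

Lemma inner_ge0 u : 0 <= inner u u.
Proof. by rewrite inner_rnorm ler0c sqr_ge0. Qed.

Lemma innerDl u v w : inner (u + v) w = inner u w + inner v w.
Proof. exact: linearDl. Qed.

Lemma innerDr u v w : inner w (u + v) = inner w u + inner w v.
Proof. exact: linearDr. Qed.

Lemma innerBl u v w : inner (u - v) w = inner u w - inner v w.
Proof. exact: linearBl. Qed.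

Lemma innerBr u v w : inner w (u - v) = inner w u - inner w v.
Proof. exact: linearBr. Qed.

Lemma innerNr u w : inner w (- u) = - inner w u.
Proof. exact: linearNr. Qed.

Lemma innerZl (a : R[i]) u w : inner (a *: u) w = a * inner u w.
Proof. exact: linearZl_LR. Qed.

Lemma innerZr (a : R[i]) u w : inner w (a *: u) = a^* * inner w u.
Proof. exact: linearZr_LR. Qed.

Lemma inner_linear (a : R[i]) u v w : inner (a *: u + v) w = a * inner u w + inner v w.
Proof. by rewrite innerDl innerZl. Qed.

Lemma inner_bound u v : rnorm (inner u v : R[i]^o) <= rnorm u * rnorm v.
Proof.
rewrite -ler_sqr ?nnegrE ?mulr_ge0 ?rnorm_ge0 // exprMn.
by have := cauchy_schwarz inner_linear innerC inner_ge0 u v; rewrite !inner_rnorm.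
Qed.

Lemma sqr_rnormD u v :
  rnorm (u + v) ^+ 2 = rnorm u ^+ 2 + rnorm v ^+ 2 + 2 * complex.Re (inner u v).
Proof.
have ReE w : rnorm w ^+ 2 = complex.Re (inner w w) by rewrite inner_rnorm.
have -> : rnorm (u + v) ^+ 2 =
    complex.Re (inner u u + inner u v + ((inner u v)^* + inner v v)).
  by rewrite ReE innerDl !innerDr -innerC.
by rewrite !ReD ReJ -!ReE; ring.
Qed.

Lemma inner_ext u v : (forall w, inner w u = inner w v) -> u = v.
Proof.
move=> uv; apply/eqP; rewrite -subr_eq0 -rnorm_eq0 -sqrf_eq0.
by rewrite -(inj_eq (@complexI _)) -inner_rnorm innerBr uv subrr.
Qed.

Lemma inner_extl u v : (forall w, inner u w = inner v w) -> u = v.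
Proof. by move=> uv; apply: inner_ext => w; rewrite innerC uv -innerC. Qed.

Lemma cvg_innerl (a : nat -> H) u v :
  a @ \oo --> u -> (fun n => inner (a n) v : R[i]^o) @ \oo --> (inner u v : R[i]^o).
Proof.
move=> au; apply: (@cvg_rnorm_lipschitz _ _ _ (rnorm v) _ _ _ _ au) => n.
by rewrite -innerBl mulrC inner_bound.
Qed.

Lemma cvg_innerr (a : nat -> H) u v :
  a @ \oo --> u -> (fun n => inner v (a n) : R[i]^o) @ \oo --> (inner v u : R[i]^o).
Proof.
move=> au; apply: (@cvg_rnorm_lipschitz _ _ _ (rnorm v) _ _ _ _ au) => n.
by rewrite -innerBr inner_bound.
Qed.

End InnerProduct.

Section Riesz.
Variables (R : realType) (H : hilbertType R).

(** Minimise F u = |u|^2 - 2 Re (phi u), which is |u - w|^2 - |w|^2 for the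
vector w sought. F is bounded below, the parallelogram identity makes
minimising sequences Cauchy, and the vanishing of the first variation of F at
the minimiser gives Re (phi v) = Re <v, w> for every v. *)
Lemma riesz (phi : H -> R[i]) (M : R) :
  (forall a u v, phi (a *: u + v) = a * phi u + phi v) ->
  (forall u, rnorm (phi u : R[i]^o) <= M * rnorm u) ->
  exists w, forall u, phi u = inner u w.
Proof.
move=> phil phib.
pose F u := rnorm u ^+ 2 - 2 * complex.Re (phi u).
have phiD u v : phi (u + v) = phi u + phi v by have := phil 1 u v; rewrite scale1r mul1r.
have phi0 : phi 0 = 0 by apply: (addrI (phi 0)); rewrite -phiD !addr0.
have phiZ a u : phi (a *: u) = a * phi u by have := phil a u 0; rewrite !addr0 phi0 addr0.
have phiN u : phi (- u) = - phi u by rewrite -scaleN1r phiZ mulN1r.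
have Fge u : - M ^+ 2 <= F u.
  have := le_trans (ler_norm _) (le_trans (ler_Re_rnorm _) (phib u)).
  have := sqr_ge0 (rnorm u - M); rewrite /F; nra.
have Finf : has_inf (range F).
  split; first by exists (F 0); exists 0.
  by exists (- M ^+ 2) => _ [u _ <-]; exact: Fge.
pose m := inf (range F).
have Fm u : m <= F u by apply: ge_inf; [case: Finf | exists u].
have near_min n : exists u, F u <= m + n.+1%:R^-1.
  have n0 : 0 < n.+1%:R^-1 :> R by rewrite invr_gt0 ltr0n.
  by have [_ [u _ <-] /ltW Fu] := inf_adherent n0 Finf; exists u.
have /choice [u Fu] := near_min.
(* Parallelogram identity, together with F at the midpoint being at least m. *)
have close a b : rnorm (a - b) ^+ 2 <= 2 * (F a - m) + 2 * (F b - m).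
  have := Fm (2^-1%:C *: (a + b)).
  have h2 : 0 <= 2^-1 :> R by rewrite invr_ge0.
  rewrite /F rnormCZ phiZ ReCM phiD ReD exprMn ger0_norm //.
  rewrite !sqr_rnormD rnormN innerNr ReN.
  lra.
have [w uw] : exists w : H, u @ \oo --> w.
  apply: rnorm_cauchy_cvg => e e0.
  have e20 : 0 < e ^+ 2 / 4 by rewrite divr_gt0 // exprn_gt0.
  have [N _ hN] := near_infty_natSinv_lt (PosNum e20).
  exists N => a b Na Nb.
  rewrite -ler_sqr ?nnegrE ?rnorm_ge0 ?(ltW e0) //.
  have /ltW /= := hN a Na; have /ltW /= := hN b Nb.
  have := close (u a) (u b); have := Fu a; have := Fu b.
  move: (F (u a)) (F (u b)) a.+1%:R^-1 b.+1%:R^-1 (rnorm _ ^+ 2) (e ^+ 2) => *; lra.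
have Fw : F w <= m.
  have cF : (fun n => F (u n)) @ \oo --> F w.
    have cn : (fun n => rnorm (u n)) @ \oo --> rnorm w by exact: cvg_rnorm.
    have cphi : (fun n => complex.Re (phi (u n))) @ \oo --> complex.Re (phi w).
      have cp : (fun n => phi (u n) : R[i]^o) @ \oo --> (phi w : R[i]^o).
        by apply: (cvg_rnorm_lipschitz uw) => n; rewrite -phiN -phiD; exact: phib.
      move/cvg_rnormP in cp; apply/cvgrPdist_le => e /cp; apply: filterS => n.
      by rewrite distrC -ReB; apply: le_trans (ler_Re_rnorm _).
    apply: cvgB; first exact: (cvgM cn cn).
    by apply: cvgM => //; exact: cvg_cst.
  have cm : (fun n => m + n.+1%:R^-1) @ \oo --> m.
    by rewrite -[X in _ --> X]addr0; apply: cvgD; [exact: cvg_cst | exact: cvg_harmonic].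
  rewrite -(cvg_lim (@Rhausdorff R) cF) -(cvg_lim (@Rhausdorff R) cm).
  by apply: ler_lim; [apply/cvg_ex; exists (F w) | apply/cvg_ex; exists m | exact: nearW].
have stat v : complex.Re (phi v) = complex.Re (inner v w).
  have var (t : R) : 0 <= t ^+ 2 * rnorm v ^+ 2
      + 2 * t * (complex.Re (inner v w) - complex.Re (phi v)).
    have := le_trans Fw (Fm (w + t%:C *: v)).
    rewrite /F sqr_rnormD rnormCZ exprMn real_normK ?num_real // phiD phiZ ReD ReCM.
    rewrite (innerC w) ReJ innerZl ReCM; lra.
  set D := complex.Re (inner v w) - _ in var; apply/eqP; rewrite eq_sym -subr_eq0 -/D.
  set A := rnorm v ^+ 2 in var; have A0 : 0 <= A by exact: sqr_ge0.
  have A1 : 0 < A + 1 by rewrite ltr_wpDl.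
  (* Any small positive multiple of -D would do; A + 1 avoids the case v = 0. *)
  have := var (- D / (A + 1)).
  have -> : (- D / (A + 1)) ^+ 2 * A + 2 * (- D / (A + 1)) * D
      = - (D ^+ 2 * ((A + 2) / (A + 1) ^+ 2)) by field; rewrite gt_eqF.
  rewrite oppr_ge0 pmulr_lle0; last by rewrite divr_gt0 ?exprn_gt0 // ltr_wpDl.
  by rewrite -sqrf_eq0 => h; rewrite eq_le h sqr_ge0.
exists w => v; apply/eqP; rewrite eq_complex stat eqxx /=.
by rewrite !ImE_Re -phiZ stat innerZl.
Qed.

End Riesz.

(** The adjoint at a represents the bounded functional v |-> <T v, a>. *)
Lemma adjoint_exists (R : realType) (H K : hilbertType R) (T : {linear H -> K}) (M : R) :
  (forall v, rnorm (T v) <= M * rnorm v) ->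
  exists T' : {linear K -> H}, forall a v, inner (T' a) v = inner a (T v).
Proof.
move=> Tb.
have /choice [D hD] : forall a : K, exists w : H, forall v, inner (T v) a = inner v w.
  move=> a; apply: (@riesz _ _ (fun v => inner (T v) a) (rnorm a * M)).
    by move=> c u v; rewrite linearP inner_linear.
  move=> v; apply: le_trans (inner_bound _ _) _.
  by rewrite mulrC -mulrA ler_wpM2l ?rnorm_ge0.
have Dlin : linear D.
  move=> c a b; apply: inner_ext => v.
  by rewrite -hD !innerDr !innerZr -!hD.
have [T' T'E] := linear_function_bundle Dlin.
by exists T' => a v; rewrite T'E innerC -hD -innerC.
Qed.
(** * Inverse square roots of positive invertible operators *)

Section ContractionSquareRoot.
Variables (R : realType) (H : hilbertType R) (X : {linear H -> H}) (q : R).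
Hypothesis q01 : 0 <= q < 1.
Hypothesis Xq : forall v, rnorm (X v) <= q * rnorm v.
Hypothesis Xsa : forall u v, inner (X u) v = inner u (X v).

(** Solves (1 - Y)^2 = 1 - X, that is Y = (X + Y^2) / 2, by iteration. All the
iterates are polynomials in X, hence commute and are self-adjoint. *)
Fixpoint sqrt_iter (n : nat) : H -> H :=
  if n is m.+1 then fun v => 2^-1%:C *: (X v + sqrt_iter m (sqrt_iter m v))
  else fun=> 0.

Let q0 : 0 <= q. Proof. by case/andP: q01. Qed.
Let q1 : q < 1. Proof. by case/andP: q01. Qed.
Let half_ge0 : 0 <= 2^-1 :> R. Proof. by rewrite invr_ge0. Qed.

Lemma sqrt_iterS n v :
  sqrt_iter n.+1 v = 2^-1%:C *: (X v + sqrt_iter n (sqrt_iter n v)).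
Proof. by []. Qed.

Lemma sqrt_iter_linear n : linear (sqrt_iter n).
Proof.
elim: n => [|n IH] a u v /=; first by rewrite scaler0 addr0.
by rewrite linearP !IH !(scalerDr, scalerA) addrACA [a * _]mulrC.
Qed.

Lemma sqrt_iterB n u v : sqrt_iter n (u - v) = sqrt_iter n u - sqrt_iter n v.
Proof.
have [g gE] := linear_function_bundle (@sqrt_iter_linear n).
by rewrite -!gE linearB.
Qed.

Lemma sqrt_iter_bound n v : rnorm (sqrt_iter n v) <= q * rnorm v.
Proof.
elim: n v => [|n IH] v /=; first by rewrite rnorm0 mulr_ge0 ?rnorm_ge0.
rewrite rnormCZ ger0_norm //.
have Yv : rnorm (sqrt_iter n (sqrt_iter n v)) <= q * rnorm v.
  apply: le_trans (IH _) _; apply: ler_wpM2l => //.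
  apply: le_trans (IH v) _; rewrite ler_piMl ?rnorm_ge0 //.
  exact: ltW.
have := ler_rnormD (X v) (sqrt_iter n (sqrt_iter n v)); have := Xq v; lra.
Qed.

Lemma sqrt_iter_selfadjoint n u v :
  inner (sqrt_iter n u) v = inner u (sqrt_iter n v).
Proof.
elim: n u v => [|n IH] u v /=; first by rewrite linear0l linear0r.
by rewrite innerZl innerZr conj_realC innerDl innerDr Xsa !IH.
Qed.

Lemma sqrt_iter_commute (f : H -> H) n v : linear f ->
  (forall w, f (X w) = X (f w)) -> f (sqrt_iter n v) = sqrt_iter n (f v).
Proof.
move=> /linear_function_bundle[g gE] fX.
elim: n v => [|n IH] v /=; first by rewrite -gE linear0.
by rewrite -gE linearZ linearD /= !gE fX !IH.
Qed.

Lemma sqrt_iterC m n v :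
  sqrt_iter m (sqrt_iter n v) = sqrt_iter n (sqrt_iter m v).
Proof.
apply: sqrt_iter_commute; first exact: sqrt_iter_linear.
by move=> w; rewrite -(sqrt_iter_commute (f := X)) //; exact: linearP.
Qed.

(** Because consecutive iterates commute,
Y_(n+2) - Y_(n+1) = (Y_(n+1) + Y_n) (Y_(n+1) - Y_n) / 2, and the first factor
has norm at most 2 q; so the steps shrink geometrically at each vector. *)
Lemma sqrt_iter_step n v :
  rnorm (sqrt_iter n.+1 v - sqrt_iter n v) <= rnorm v * q ^+ n.
Proof.
elim: n => [|n IH].
  rewrite subr0 /= addr0 rnormCZ ger0_norm // expr0 mulr1.
  have : q * rnorm v <= rnorm v by rewrite ler_piMl ?rnorm_ge0 // ltW.
  have := rnorm_ge0 v; have := Xq v; lra.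
set w := sqrt_iter n.+1 v - sqrt_iter n v in IH.
have -> : sqrt_iter n.+2 v - sqrt_iter n.+1 v
    = 2^-1%:C *: (sqrt_iter n.+1 w + sqrt_iter n w).
  rewrite /w !sqrt_iterB (sqrt_iterC n n.+1) addrA subrK.
  rewrite (sqrt_iterS n.+1 v) [X in _ - X = _](sqrt_iterS n v).
  by rewrite -scalerBr opprD addrACA subrr add0r.
rewrite rnormCZ ger0_norm // exprS mulrCA.
have := ler_rnormD (sqrt_iter n.+1 w) (sqrt_iter n w).
have := sqrt_iter_bound n.+1 w; have := sqrt_iter_bound n w.
have := ler_wpM2l q0 IH; lra.
Qed.

(** In other words 1 - Y is a self-adjoint square root of 1 - X. *)
Lemma contraction_square_root : exists Y : {linear H -> H},
  [/\ forall v, rnorm (Y v) <= q * rnorm v,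
      forall u v, inner (Y u) v = inner u (Y v)
    & forall v, Y v + Y v = X v + Y (Y v)].
Proof.
have /choice [Y YnY] : forall v, exists l : H, (fun n => sqrt_iter n v) @ \oo --> l.
  by move=> v; apply: geometric_steps_cvg q01 (fun n => sqrt_iter_step n v).
have Ylin : linear Y.
  move=> a u v; apply: (limit_unique _ (YnY _)) => [n|]; first exact: sqrt_iter_linear.
  by apply: cvgD => //; exact: cvgZr.
have Yb v : rnorm (Y v) <= q * rnorm v.
  apply: (rnorm_limit_le (YnY v) (cvg_cst _)) => n /=; exact: sqrt_iter_bound.
have [Z ZE] := linear_function_bundle Ylin.
exists Z; split=> [v|u v|v]; rewrite !ZE //.
  have e n : inner (sqrt_iter n u) v = inner u (sqrt_iter n v) :> R[i]^o.
    exact: sqrt_iter_selfadjoint.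
  exact: limit_unique e (cvg_innerl (YnY u)) (cvg_innerr (YnY v)).
(* Squares converge: the iterates are uniformly q-Lipschitz. *)
have YY : (fun n => sqrt_iter n (sqrt_iter n v)) @ \oo --> Y (Y v).
  rewrite -[Y (Y v)]add0r.
  have E n : sqrt_iter n (sqrt_iter n v)
      = sqrt_iter n (sqrt_iter n v - Y v) + sqrt_iter n (Y v).
    by rewrite sqrt_iterB subrK.
  rewrite (funext E); apply: cvgD => //; apply: (cvg_rnorm_lipschitz (YnY v)) => n.
  by rewrite subr0; exact: sqrt_iter_bound.
have half2 (w : H) : 2^-1%:C *: w + 2^-1%:C *: w = w.
  have h : 2^-1 + 2^-1 = 1 :> R by lra.
  by rewrite -scalerDl -rmorphD /= h scale1r.
suff YE : Y v = 2^-1%:C *: (X v + Y (Y v)) by rewrite {1 2}YE half2.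
have YS : (fun n => sqrt_iter n.+1 v) @ \oo --> Y v.
  by have := YnY v; rewrite -(cvg_shiftS (fun n => sqrt_iter n v)).
apply: (limit_unique _ YS) => [n|]; first exact: sqrt_iterS.
by apply: cvgZr; apply: cvgD => //; exact: cvg_cst.
Qed.

End ContractionSquareRoot.

(** 1 - Y is bounded below by 1 - q, hence injective with a bounded inverse; it
is onto because u = v + Y u is solved by iteration. *)
Lemma neumann_inverse (R : realType) (H : hilbertType R) (Y : {linear H -> H}) (q : R) :
  0 <= q < 1 -> (forall v, rnorm (Y v) <= q * rnorm v) ->
  exists Z : {linear H -> H},
    [/\ forall v, rnorm (Z v) <= (1 - q)^-1 * rnorm v,
        forall v, Z v - Y (Z v) = v & forall v, Z (v - Y v) = v].
Proof.
move=> q01 Yq; have /andP[q0 q1] := q01.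
have q1' : 0 < 1 - q by rewrite subr_gt0.
have low v : rnorm v <= (1 - q)^-1 * rnorm (v - Y v).
  rewrite mulrC ler_pdivlMr //.
  have := ler_rnormD (v - Y v) (Y v); rewrite subrK; have := Yq v; lra.
have inj u v : u - Y u = v - Y v -> u = v.
  move=> uv; apply/eqP; rewrite -subr_eq0 -rnorm_eq0 eq_le rnorm_ge0 andbT.
  apply: le_trans (low _) _.
  suff -> : u - v - Y (u - v) = 0 by rewrite rnorm0 mulr0.
  rewrite linearB opprB [Y v - Y u]addrC addrACA uv.
  by rewrite [- v + _]addrC -[Y v - v]opprB subrr.
have /choice [Z ZE] : forall v, exists u, u - Y u = v.
  move=> v; pose u := fix u n := if n is m.+1 then v + Y (u m) else 0 : H.
  have ustep n : rnorm (u n.+1 - u n) <= rnorm v * q ^+ n.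
    elim: n => [|n IH]; first by rewrite /= linear0 addr0 subr0 mulr1.
    rewrite [u n.+2]/= -/(u n.+1) [in X in _ - X]/= -/(u n) opprD addrACA subrr add0r.
    rewrite -linearB; apply: le_trans (Yq _) _; rewrite exprS mulrCA.
    exact: ler_wpM2l.
  have [l ul] := geometric_steps_cvg q01 ustep.
  have uS : (fun n => v + Y (u n)) @ \oo --> l.
    by move: ul; rewrite -(cvg_shiftS u).
  have vl : (fun n => v + Y (u n)) @ \oo --> v + Y l.
    apply: cvgD; first exact: cvg_cst.
    by apply: (cvg_rnorm_lipschitz ul) => n; rewrite -linearB.
  by exists l; rewrite {1}(limit_unique (fun=> erefl) uS vl) addrK.
have Zlin : linear Z.
  move=> a u v; apply: inj; rewrite ZE linearP opprD addrACA -scalerBr.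
  by rewrite !ZE.
have [Z' Z'E] := linear_function_bundle Zlin.
exists Z'; split=> v; rewrite !Z'E ?ZE //; first by rewrite -{2}(ZE v).
by apply: inj; rewrite ZE.
Qed.

(** L is S^(-1/2). Put X = 1 - S / B; then 0 <= X <= 1 - A / B < 1, so X is a
strict contraction, 1 - X = S / B has a square root 1 - Y with Y again a strict
contraction, and L = B^(-1/2) (1 - Y)^(-1). The last conclusion says that
L S L is the identity. *)
Lemma inverse_square_root (R : realType) (H : hilbertType R) (S : {linear H -> H})
    (A B : R) : 0 < A -> A <= B ->
  (forall u v, inner (S u) v = inner u (S v)) ->
  (forall v, A * rnorm v ^+ 2 <= complex.Re (inner (S v) v) <= B * rnorm v ^+ 2) ->
  exists L L' : {linear H -> H},
    [/\ bounded_operator L, bounded_operator L', cancel L L', cancel L' L &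
     (forall u v, inner (L u) v = inner u (L v)) /\
     (forall u v, inner (S (L u)) (L v) = inner u v)].
Proof.
move=> A0 AB Ssa SAB.
have B0 : 0 < B by exact: lt_le_trans AB.
have Bn0 : B != 0 by rewrite gt_eqF.
pose q := 1 - A / B.
have q01 : 0 <= q < 1.
  by rewrite subr_ge0 ler_pdivrMr // mul1r AB ltrBlDr ltrDl divr_gt0.
have /andP[q0 q1] := q01.
have Xlin : linear (fun v => v - (B^-1)%:C *: S v).
  move=> a u v; rewrite linearP scalerDr opprD addrACA scalerBr !scalerA.
  by rewrite [_%:C * a]mulrC.
have [X XE] := linear_function_bundle Xlin.
have Xsa u v : inner (X u) v = inner u (X v).
  by rewrite !XE innerBl innerBr innerZl innerZr conj_realC Ssa.
have ReX v : complex.Re (inner (X v) v) = rnorm v ^+ 2 - B^-1 * complex.Re (inner (S v) v).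
  by rewrite XE innerBl innerZl ReB ReCM inner_rnorm.
have ImX v : complex.Im (inner (X v) v) = 0.
  apply: complexI; apply: RIm_real; apply/CrealP.
  by rewrite -innerC Xsa.
have Xpos v : 0 <= inner (X v) v.
  rewrite lecE ImX eqxx /= ReX subr_ge0 mulrC ler_pdivrMr // mulrC.
  by case/andP: (SAB v).
have Xle v : complex.Re (inner (X v) v) <= q * rnorm v ^+ 2.
  rewrite ReX /q mulrBl mul1r lerD2l lerN2 mulrAC mulrC ler_pM2l ?invr_gt0 //.
  by case/andP: (SAB v).
have Xq v : rnorm (X v) <= q * rnorm v.
  have Xlin' a u w z : inner (X (a *: u + w)) z = a * inner (X u) z + inner (X w) z.
    by rewrite linearP inner_linear.
  have Xherm u w : inner (X u) w = (inner (X w) u)^* by rewrite Xsa innerC.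
  have := cauchy_schwarz Xlin' Xherm Xpos v (X v).
  have p0 w : 0 <= complex.Re (inner (X w) w) by rewrite -ler0c RRe_real // ger0_real.
  move=> /le_trans /(_ (ler_pM (p0 _) (p0 _) (Xle _) (Xle _))).
  have [->|Xv0] := eqVneq (rnorm (X v)) 0; first by rewrite mulr_ge0 ?rnorm_ge0.
  have Xvpos : 0 < rnorm (X v) by rewrite lt_def Xv0 rnorm_ge0.
  rewrite inner_rnorm rnorm_realC real_normK ?num_real // => h.
  rewrite -ler_sqr ?nnegrE ?mulr_ge0 ?rnorm_ge0 //.
  rewrite -(ler_pM2r (exprn_gt0 2 Xvpos)); rewrite -expr2; apply: (le_trans h).
  by rewrite le_eqVlt; apply/orP; left; apply/eqP; ring.
have [Y [Yq Ysa YE]] := contraction_square_root q01 Xq Xsa.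
have [Z [Zb YZ ZY]] := neumann_inverse q01 Yq.
pose b := Num.sqrt B; have b0 : b != 0 by rewrite sqrtr_eq0 -ltNge.
have bb : b * b = B by rewrite -expr2 sqr_sqrtr // ltW.
have RR v : (v - Y v) - Y (v - Y v) = (B^-1)%:C *: S v.
  have -> : v - Y v - Y (v - Y v) = v - (Y v + Y v - Y (Y v)).
    by rewrite linearB !opprB opprD !addrA; congr (_ - _); rewrite addrAC.
  by rewrite YE addrK XE subKr.
have Rsa u v : inner (u - Y u) v = inner u (v - Y v).
  by rewrite innerBl innerBr Ysa.
have Zsa u v : inner (Z u) v = inner u (Z v).
  by rewrite -{1}(YZ v) -Rsa YZ.
have Llin : linear (fun v => b^-1%:C *: Z v).
  by move=> a u v; rewrite linearP scalerDr !scalerA [a * _]mulrC.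
have L'lin : linear (fun v => b%:C *: (v - Y v)).
  move=> a u v; rewrite linearP opprD addrACA -scalerBr scalerDr !scalerA.
  by rewrite [a * _]mulrC.
have [L LE] := linear_function_bundle Llin.
have [L' L'E] := linear_function_bundle L'lin.
have bC : b^-1%:C * b%:C = 1 :> R[i] by rewrite -rmorphM /= mulVf.
exists L, L'; split.
- exists (`|b^-1| * (1 - q)^-1) => v; rewrite LE rnormCZ -mulrA.
  exact: ler_wpM2l.
- exists (`|b| * (1 + q)) => v; rewrite L'E rnormCZ -mulrA.
  apply: ler_wpM2l => //; apply: le_trans (ler_rnormD _ _) _.
  by rewrite rnormN mulrDl mul1r lerD2l.
- move=> v; by rewrite L'E LE linearZ /= -scalerBr scalerA [_ * _]mulrC bC scale1r YZ.
- move=> v; by rewrite LE L'E linearZ /= ZY scalerA bC scale1r.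
split=> u v.
  by rewrite !LE innerZl innerZr conj_realC Zsa.
have SE w : S w = B%:C *: ((w - Y w) - Y (w - Y w)).
  by rewrite RR scalerA -rmorphM /= mulfV // scale1r.
rewrite !LE innerZr conj_realC [S _]linearZ innerZl SE YZ innerZl Rsa YZ !mulrA.
suff -> : b^-1%:C * b^-1%:C * B%:C = 1 by rewrite mul1r.
by rewrite -bb -!rmorphM /= -invfM mulVf // mulf_neq0.
Qed.

(** * Unordered sums of real families *)

Section RealSums.
Variables (R : realType) (I : choiceType).
Implicit Types (f g h : I -> R) (c : R).

Definition asum f : \bar R := (\esum_(i in [set: I]) (f i)%:E)%E.
Definition psum f : R := fine (asum f).

Lemma asum_ge0 f : (forall i, 0 <= f i) -> (0 <= asum f)%E.
Proof. by move=> f0; apply: esum_ge0 => i _; rewrite lee_fin. Qed.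

Lemma le_asum f g : (forall i, f i <= g i) -> (asum f <= asum g)%E.
Proof. by move=> fg; apply: le_esum => i _; rewrite lee_fin. Qed.

Lemma asumD f g : (forall i, 0 <= f i) -> (forall i, 0 <= g i) ->
  asum (fun i => f i + g i) = (asum f + asum g)%E.
Proof.
move=> f0 g0; rewrite -esumD => [|i _|i _]; rewrite ?lee_fin //.
Qed.

Lemma psumK f : (forall i, 0 <= f i) -> (asum f < +oo)%E -> (psum f)%:E = asum f.
Proof. by move=> /asum_ge0 f0 foo; rewrite fineK // ge0_fin_numE. Qed.

Lemma eq_psum f g : f =1 g -> psum f = psum g.
Proof. by move=> /funext ->. Qed.

Lemma psum_ge0 f : (forall i, 0 <= f i) -> 0 <= psum f.
Proof. by move=> f0; apply: fine_ge0; exact: asum_ge0. Qed.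

Lemma asumD_lty f g : (forall i, 0 <= f i) -> (forall i, 0 <= g i) ->
  (asum f < +oo)%E -> (asum g < +oo)%E -> (asum (fun i => f i + g i)%R < +oo)%E.
Proof. by move=> f0 g0 fo go; rewrite asumD // lte_add_pinfty. Qed.

Lemma psumD f g : (forall i, 0 <= f i) -> (forall i, 0 <= g i) ->
  (asum f < +oo)%E -> (asum g < +oo)%E ->
  psum (fun i => f i + g i) = psum f + psum g.
Proof.
move=> f0 g0 fo go; apply: EFin_inj.
have fg0 i : 0 <= f i + g i by rewrite addr_ge0.
by rewrite EFinD (psumK fg0 (asumD_lty f0 g0 fo go)) !psumK // asumD.
Qed.

Lemma asum_le f (M : R) :
  (forall X : {fset I}, \sum_(i <- X) f i <= M) -> (asum f <= M%:E)%E.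
Proof.
move=> fM; apply: ge_ereal_sup => _ [X [Xf _] <-].
by rewrite fsumEFin // fsbig_finite //= lee_fin.
Qed.

Lemma asum_ge f (X : {fset I}) : ((\sum_(i <- X) f i)%:E <= asum f)%E.
Proof.
apply: esum_ge; exists [set` X]; first by split => //; exact: finite_fset.
by rewrite fsumEFin ?fsbig_finite ?set_fsetK //=; exact: finite_fset.
Qed.

Lemma psum_ge f (X : {fset I}) : (forall i, 0 <= f i) -> (asum f < +oo)%E ->
  \sum_(i <- X) f i <= psum f.
Proof. by move=> f0 fo; rewrite -lee_fin psumK // asum_ge. Qed.

Lemma psum_adherent f (e : R) : (forall i, 0 <= f i) -> (asum f < +oo)%E -> 0 < e ->
  exists X : {fset I}, psum f <= \sum_(i <- X) f i + e.
Proof.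
move=> f0 fo e0; apply: contrapT => h.
have : (asum f <= (psum f - e)%:E)%E.
  apply: asum_le => X; rewrite lerBrDr leNgt; apply/negP => hX; apply: h.
  by exists X; exact: ltW.
by rewrite -psumK // lee_fin lerBrDr gerDl leNgt e0.
Qed.

Lemma asumZ_le f c : 0 <= c -> (forall i, 0 <= f i) -> (asum f < +oo)%E ->
  (asum (fun i => (c * f i)%R) <= (c * psum f)%:E)%E.
Proof.
move=> c0 f0 fo; apply: asum_le => X; rewrite -mulr_sumr.
by rewrite ler_wpM2l // psum_ge.
Qed.

Lemma psumZ f c : 0 <= c -> (forall i, 0 <= f i) -> (asum f < +oo)%E ->
  psum (fun i => c * f i) = c * psum f.
Proof.
move=> c0 f0 fo; have cf0 i : 0 <= c * f i by rewrite mulr_ge0.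
have cfo := le_lt_trans (asumZ_le c0 f0 fo) (ltry _).
apply/le_anti/andP; split; first by rewrite -lee_fin psumK // asumZ_le.
case: (eqVneq c 0) => [->|cn0].
  by rewrite mul0r psum_ge0 // => i; rewrite mul0r.
have cpos : 0 < c by rewrite lt_def cn0.
rewrite mulrC -ler_pdivlMr // mulrC -lee_fin psumK //.
have ci0 : 0 <= c^-1 by rewrite invr_ge0 ltW.
apply: le_trans (asumZ_le ci0 cf0 cfo); apply: le_asum => i.
by rewrite mulKf // gt_eqF.
Qed.

Definition asummable f := (asum (fun i => `|f i|%R) < +oo)%E.

(** Since f = (|f| + f) - |f| with both terms nonnegative, sums of nonnegative
families suffice, without positive and negative parts. *)
Definition rsum f : R := psum (fun i => `|f i| + f i) - psum (fun i => `|f i|).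

(** The value does not depend on the decomposition of f into nonnegative
summable parts; linearity then reduces to additivity on nonnegative families. *)
Lemma rsumE f g h : (forall i, 0 <= g i) -> (forall i, 0 <= h i) ->
  (asum g < +oo)%E -> (asum h < +oo)%E -> (forall i, f i = g i - h i) ->
  rsum f = psum g - psum h.
Proof.
move=> g0 h0 go ho fE; have fb i : `|f i| <= g i + h i.
  by rewrite fE; apply: le_trans (ler_normB _ _) _; rewrite !ger0_norm.
have fo : asummable f by apply: le_lt_trans (le_asum fb) (asumD_lty _ _ _ _).
have p0 i : 0 <= `|f i| + f i by rewrite -lerBlDr sub0r -normrN ler_norm.
have po : (asum (fun i => `|f i| + f i)%R < +oo)%E.
  apply: (@le_lt_trans _ _ (asum (fun i => `|f i| + `|f i|))%R).
    by apply: le_asum => i; rewrite lerD2l ler_norm.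
  exact: asumD_lty.
apply/eqP; rewrite /rsum subr_eq addrAC eq_sym subr_eq -!psumD //.
by apply/eqP/eq_psum => i; rewrite fE; ring.
Qed.

Lemma rsum_nneg f : (forall i, 0 <= f i) -> (asum f < +oo)%E -> rsum f = psum f.
Proof.
move=> f0 fo; have z0 : asum (fun=> 0%R) = 0%E by apply: esum1.
rewrite (@rsumE f f (fun=> 0)) ?z0 //; last by move=> i; rewrite subr0.
by rewrite /psum z0 subr0.
Qed.

Lemma asummable_le f g : (forall i, `|f i| <= g i) -> (asum g < +oo)%E -> asummable f.
Proof. by move=> fg; apply: le_lt_trans (le_asum fg). Qed.

Lemma asummableD f g : asummable f -> asummable g -> asummable (fun i => f i + g i).
Proof.
move=> fo go; apply: (asummable_le (g := fun i => `|f i| + `|g i|)).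
  by move=> i; exact: ler_normD.
exact: asumD_lty.
Qed.

Lemma asummableZ c f : asummable f -> asummable (fun i => c * f i).
Proof.
move=> fo; apply: (asummable_le (g := fun i => `|c| * `|f i|)).
  by move=> i; rewrite normrM.
by apply: le_lt_trans (asumZ_le _ _ fo) (ltry _).
Qed.

Lemma rsum_decomp f : asummable f -> exists g h,
  [/\ forall i, 0 <= g i, forall i, 0 <= h i, (asum g < +oo)%E, (asum h < +oo)%E
    & (forall i, f i = g i - h i) ].
Proof.
move=> fo; exists (fun i => `|f i| + f i), (fun i => `|f i|); split => //.
- by move=> i; rewrite -lerBlDr sub0r -normrN ler_norm.
- apply: (@le_lt_trans _ _ (asum (fun i => `|f i| + `|f i|))%R).
    by apply: le_asum => i; rewrite lerD2l ler_norm.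
  exact: asumD_lty.
- by move=> i; rewrite addrC addKr.
Qed.

Lemma rsumD f g : asummable f -> asummable g ->
  rsum (fun i => f i + g i) = rsum f + rsum g.
Proof.
move=> /rsum_decomp[f1 [f2 [f10 f20 f1o f2o fE]]].
move=> /rsum_decomp[g1 [g2 [g10 g20 g1o g2o gE]]].
rewrite (rsumE f10 f20 f1o f2o fE) (rsumE g10 g20 g1o g2o gE).
rewrite (@rsumE _ (fun i => f1 i + g1 i) (fun i => f2 i + g2 i)).
- by rewrite !psumD //; ring.
- by move=> i; rewrite addr_ge0.
- by move=> i; rewrite addr_ge0.
- exact: asumD_lty.
- exact: asumD_lty.
- by move=> i; rewrite fE gE; ring.
Qed.

Lemma rsumN f : asummable f -> rsum (fun i => - f i) = - rsum f.
Proof.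
move=> /rsum_decomp[f1 [f2 [f10 f20 f1o f2o fE]]].
rewrite (rsumE f10 f20 f1o f2o fE) (@rsumE _ f2 f1) ?opprB // => i.
by rewrite fE opprB.
Qed.

Lemma rsumZ_ge0 c f : 0 <= c -> asummable f -> rsum (fun i => c * f i) = c * rsum f.
Proof.
move=> c0 /rsum_decomp[f1 [f2 [f10 f20 f1o f2o fE]]].
rewrite (rsumE f10 f20 f1o f2o fE) (@rsumE _ (fun i => c * f1 i) (fun i => c * f2 i)).
- by rewrite !psumZ // mulrBr.
- by move=> i; rewrite mulr_ge0.
- by move=> i; rewrite mulr_ge0.
- exact: le_lt_trans (asumZ_le _ _ _) (ltry _).
- exact: le_lt_trans (asumZ_le _ _ _) (ltry _).
- by move=> i; rewrite fE mulrBr.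
Qed.

Lemma rsumZ c f : asummable f -> rsum (fun i => c * f i) = c * rsum f.
Proof.
move=> fo; case: (leP 0 c) => c0; first exact: rsumZ_ge0.
have nc0 : 0 <= - c by rewrite oppr_ge0 ltW.
have -> : (fun i => c * f i) = (fun i => - (- c * f i)).
  by apply/funext => i; rewrite mulNr opprK.
by rewrite rsumN ?rsumZ_ge0 ?mulNr ?opprK //; exact: asummableZ.
Qed.

Lemma asum_single f i : 0 <= f i -> (forall j, j != i -> f j = 0) ->
  asum f = (f i)%:E.
Proof.
move=> fi0 f0; rewrite -(@esum_set1 R I i (fun j => (f j)%:E)) ?lee_fin //.
rewrite [RHS]esum_mkcond; apply: eq_esum => j _; case: ifPn => //.
by rewrite notin_setE => /eqP/f0 ->.
Qed.

Lemma rsum_single f i : (forall j, j != i -> f j = 0) -> rsum f = f i.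
Proof.
move=> f0; have aE : asum (fun j => `|f j|) = (`|f i|)%:E.
  by rewrite (@asum_single _ i) // => j /f0 ->; rewrite normr0.
have sE : asum (fun j => `|f j| + f j) = (`|f i| + f i)%:E.
  rewrite (@asum_single _ i) // => [|j /f0 ->]; last by rewrite normr0 addr0.
  by rewrite -lerBlDr sub0r -normrN ler_norm.
by rewrite /rsum /psum aE sE /= addrC addKr.
Qed.

End RealSums.

(** * The Hilbert space of square-summable families *)

Section ComplexSums.
Variables (R : realType) (I : choiceType).
Implicit Types (z w : I -> R[i]).

Definition csummable z := (asum (fun i => rnorm (z i : R[i]^o)) < +oo)%E.

Definition csum z : R[i] :=
  Complex (rsum (fun i => complex.Re (z i))) (rsum (fun i => complex.Im (z i))).

Lemma csummable_Re z : csummable z -> asummable (fun i => complex.Re (z i)).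
Proof. by apply: asummable_le => i; exact: ler_Re_rnorm. Qed.

Lemma csummable_Im z : csummable z -> asummable (fun i => complex.Im (z i)).
Proof. by apply: asummable_le => i; exact: ler_Im_rnorm. Qed.

Lemma csum_linear (c : R[i]) z w : csummable z -> csummable w ->
  csum (fun i => c * z i + w i) = c * csum z + csum w.
Proof.
move=> zo wo; have zr := csummable_Re zo; have zi := csummable_Im zo.
have wr := csummable_Re wo; have wi := csummable_Im wo.
case: c => p q; rewrite /csum; apply/eqP; rewrite eq_complex /=.
have -> : (fun i => complex.Re ((p +i* q)%C * z i + w i)) =
    (fun i => (p * complex.Re (z i) + - q * complex.Im (z i)) + complex.Re (w i)).
  by apply/funext => i; case: (z i) (w i) => [x y] [x' y'] /=; ring.
have -> : (fun i => complex.Im ((p +i* q)%C * z i + w i)) =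
    (fun i => (p * complex.Im (z i) + q * complex.Re (z i)) + complex.Im (w i)).
  by apply/funext => i; case: (z i) (w i) => [x y] [x' y'] /=; ring.
rewrite (rsumD (asummableD (asummableZ p zr) (asummableZ (- q) zi)) wr).
rewrite (rsumD (asummableD (asummableZ p zi) (asummableZ q zr)) wi).
rewrite (rsumD (asummableZ p zr) (asummableZ (- q) zi)).
rewrite (rsumD (asummableZ p zi) (asummableZ q zr)).
by rewrite !rsumZ // mulNr !eqxx.
Qed.

Lemma csumJ z : csummable z -> csum (fun i => (z i)^*) = (csum z)^*.
Proof.
move=> /csummable_Im zo; rewrite /csum.
have -> : (fun i => complex.Re (z i)^*) = (fun i => complex.Re (z i)).
  by apply/funext => i; exact: ReJ.
have -> : (fun i => complex.Im (z i)^*) = (fun i => - complex.Im (z i)).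
  by apply/funext => i; case: (z i).
by rewrite (rsumN zo).
Qed.

Lemma csum_real (f : I -> R) : (forall i, 0 <= f i) -> (asum f < +oo)%E ->
  csum (fun i => (f i)%:C) = (psum f)%:C.
Proof.
move=> f0 fo; rewrite /csum /=; congr Complex; first exact: rsum_nneg.
rewrite rsum_nneg //; last by rewrite /asum esum1 ?ltry.
by rewrite /psum /asum esum1.
Qed.

Lemma csum_single z i : (forall j, j != i -> z j = 0) -> csum z = z i.
Proof.
move=> z0; rewrite /csum.
rewrite (@rsum_single R I (fun j => complex.Re (z j)) i); last by move=> j /z0 ->.
rewrite (@rsum_single R I (fun j => complex.Im (z j)) i); last by move=> j /z0 ->.
by case: (z i).
Qed.

End ComplexSums.

Section L2Space.
Variables (R : realType) (I : choiceType).

Definition energy (a : I -> R[i]^o) : \bar R := asum (fun i => rnorm (a i) ^+ 2).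

Definition sqsum (a : I -> R[i]^o) : bool := `[< (energy a < +oo)%E >].

Lemma sqsumP (a : I -> R[i]^o) :
  reflect (energy a < +oo)%E (sqsum a).
Proof. exact: asboolP. Qed.

Lemma sqsum_closed : GRing.subsemimod_closed sqsum.
Proof.
apply: GRing.submod_closed_semi; split.
  apply/sqsumP; rewrite /energy /asum esum1 ?ltry // => i _.
  by rewrite rnorm0 expr0n.
move=> c a b /sqsumP ao /sqsumP bo; apply/sqsumP.
pose f i := 2 * rnorm (c : R[i]^o) ^+ 2 * rnorm (a i) ^+ 2.
pose g i := 2 * rnorm (b i) ^+ 2.
apply: (@le_lt_trans _ _ (asum (fun i => (f i + g i)%R))).
  apply: le_asum => i; rewrite /f /g.
  have h : rnorm ((c *: a + b) i) <= rnorm (c : R[i]^o) * rnorm (a i) + rnorm (b i).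
    by rewrite -rnormZ; exact: ler_rnormD.
  have := sqr_ge0 (rnorm (c : R[i]^o) * rnorm (a i) - rnorm (b i)).
  have := rnorm_ge0 ((c *: a + b) i).
  move: h; move: (rnorm _) (rnorm (c : R[i]^o)) (rnorm (a i)) (rnorm (b i)) => x y z t.
  nra.
apply: asumD_lty.
- by move=> i; apply: mulr_ge0; rewrite ?sqr_ge0 // pmulr_rge0 ?sqr_ge0.
- by move=> i; rewrite /g pmulr_rge0 ?sqr_ge0.
- apply: le_lt_trans (asumZ_le _ _ ao) (ltry _) => [|i]; last exact: sqr_ge0.
  by rewrite pmulr_rge0 // sqr_ge0.
- by apply: le_lt_trans (asumZ_le _ _ bo) (ltry _) => // i; exact: sqr_ge0.
Qed.

HB.instance Definition _ :=
  GRing.isSubmodClosed.Build R[i] (I -> R[i]^o) sqsum sqsum_closed.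

(** Bundled as a subtype of the functions I -> R[i], so that the vector space
structure is inherited pointwise. *)
Record l2 := L2 { l2val :> I -> R[i]^o; l2_sqsum : sqsum l2val }.

HB.instance Definition _ := [isSub for l2val].
HB.instance Definition _ := [Choice of l2 by <:].
HB.instance Definition _ := [SubChoice_isSubLmodule of l2 by <:].

Implicit Types (a b : l2).

Lemma l2D a b i : (a + b) i = a i + b i.
Proof. by []. Qed.

Lemma l2Z (c : R[i]) a i : (c *: a) i = c * a i.
Proof. by []. Qed.

Lemma l2P a b : (forall i, a i = b i) -> a = b.
Proof. by move=> ab; apply: val_inj; apply/funext. Qed.

Definition sqnorm a : R := psum (fun i => rnorm (a i) ^+ 2).

Definition l2dot a b : R[i] := csum (fun i => a i * (b i)^*).

Lemma l2_lty a : (energy a < +oo)%E.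
Proof. exact/sqsumP/l2_sqsum. Qed.

(** |a_i b_i| <= |a_i|^2 + |b_i|^2. *)
Lemma l2dot_summable a b : csummable (fun i => a i * (b i)^*).
Proof.
apply: (@le_lt_trans _ _ (asum (fun i => (rnorm (a i) ^+ 2 + rnorm (b i) ^+ 2)%R))).
  apply: le_asum => i; have := rnormZ (a i) ((b i)^* : R[i]^o).
  rewrite /GRing.scale /= => ->.
  rewrite rnormzJ; have := sqr_ge0 (rnorm (a i) - rnorm (b i)).
  have := sqr_ge0 (rnorm (a i) + rnorm (b i)); nra.
by apply: asumD_lty => [i|i||]; rewrite ?sqr_ge0 //; exact: l2_lty.
Qed.

Lemma l2dot_linear (c : R[i]) a b d : l2dot (c *: a + b) d = c * l2dot a d + l2dot b d.
Proof.
rewrite /l2dot -csum_linear; [|exact: l2dot_summable ..].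
by congr csum; apply/funext => i; rewrite l2D l2Z mulrDl mulrA.
Qed.

Lemma l2dotC a b : l2dot a b = (l2dot b a)^*.
Proof.
rewrite /l2dot -csumJ; last exact: l2dot_summable.
by congr csum; apply/funext => i; rewrite rmorphM /= conjCK mulrC.
Qed.

Lemma l2dot_sqnorm a : l2dot a a = (sqnorm a)%:C.
Proof.
rewrite -csum_real; last exact: l2_lty.
  by congr csum; apply/funext => i; rewrite rnormz_conj.
by move=> i; exact: sqr_ge0.
Qed.

Lemma sqnorm_ge0 a : 0 <= sqnorm a.
Proof. by apply: psum_ge0 => i; exact: sqr_ge0. Qed.

Lemma l2_coord_le a i : rnorm (a i) ^+ 2 <= sqnorm a.
Proof.
have := @psum_ge _ _ (fun j => rnorm (a j) ^+ 2) [fset i]%fset _ (l2_lty a).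
by rewrite big_seq_fset1; apply => j; exact: sqr_ge0.
Qed.

Definition l2norm a : R[i] := (Num.sqrt (sqnorm a))%:C.

Lemma l2normZ (c : R[i]) a : l2norm (c *: a) = `|c| * l2norm a.
Proof.
have dZ d e : l2dot (c *: d) e = c * l2dot d e.
  rewrite -[c *: d]addr0 l2dot_linear.
  suff -> : l2dot 0 e = 0 by rewrite addr0.
  have := l2dot_linear 1 0 0 e; rewrite scale1r addr0 mul1r => /eqP.
  by rewrite addrC -subr_eq subrr => /eqP.
have e : sqnorm (c *: a) = rnorm (c : R[i]^o) ^+ 2 * sqnorm a.
  apply: complexI; rewrite -l2dot_sqnorm dZ l2dotC dZ rmorphM /= -l2dotC.
  by rewrite mulrA -rnormz_conj l2dot_sqnorm -rmorphM.
rewrite /l2norm e sqrtrM ?sqr_ge0 // sqrtr_sqr ger0_norm ?rnorm_ge0 //.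
by rewrite rmorphM /= (rnormE (c : R[i]^o)).
Qed.

Lemma l2normD a b : l2norm (a + b) <= l2norm a + l2norm b.
Proof.
have pos d : 0 <= l2dot d d by rewrite l2dot_sqnorm ler0c sqnorm_ge0.
have := cauchy_schwarz l2dot_linear l2dotC pos a b.
rewrite !l2dot_sqnorm => CS.
have Dl d e f : l2dot (d + e) f = l2dot d f + l2dot e f.
  by have := l2dot_linear 1 d e f; rewrite scale1r mul1r.
have Dr d e f : l2dot d (e + f) = l2dot d e + l2dot d f.
  by rewrite l2dotC Dl rmorphD /= -!l2dotC.
have sE d : sqnorm d = complex.Re (l2dot d d) by rewrite l2dot_sqnorm.
have e : sqnorm (a + b) = sqnorm a + sqnorm b + 2 * complex.Re (l2dot a b).
  rewrite !sE.
  have -> : l2dot (a + b) (a + b)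
      = l2dot a a + l2dot a b + ((l2dot a b)^* + l2dot b b) by rewrite Dl !Dr -l2dotC.
  by rewrite !ReD ReJ; ring.
rewrite /l2norm -rmorphD lecR -ler_sqr ?nnegrE ?addr_ge0 ?sqrtr_ge0 //.
rewrite sqrrD !sqr_sqrtr ?sqnorm_ge0 // e.
have : rnorm (l2dot a b : R[i]^o) <= Num.sqrt (sqnorm a) * Num.sqrt (sqnorm b).
  rewrite -ler_sqr ?nnegrE ?mulr_ge0 ?sqrtr_ge0 ?rnorm_ge0 //.
  by rewrite exprMn (sqr_sqrtr (sqnorm_ge0 a)) (sqr_sqrtr (sqnorm_ge0 b)); exact: CS.
have := le_trans (ler_norm _) (ler_Re_rnorm (l2dot a b)).
lra.
Qed.

Lemma l2norm0_eq0 a : l2norm a = 0 -> a = 0.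
Proof.
move=> /complexI /eqP; rewrite sqrtr_eq0 => a0; apply: l2P => i.
apply/eqP; rewrite -rnorm_eq0 -sqrf_eq0 eq_le sqr_ge0 andbT.
exact: le_trans (l2_coord_le a i) a0.
Qed.

HB.instance Definition _ := Lmodule_isNormed.Build R[i] l2 l2normD l2normZ l2norm0_eq0.

Lemma l2_rnorm a : rnorm a = Num.sqrt (sqnorm a).
Proof. by []. Qed.

Lemma l2_rnorm_sqr a : rnorm a ^+ 2 = sqnorm a.
Proof. by rewrite l2_rnorm sqr_sqrtr ?sqnorm_ge0. Qed.

Lemma l2_rnorm_coord a i : rnorm (a i) <= rnorm a.
Proof.
by rewrite -ler_sqr ?nnegrE ?rnorm_ge0 // l2_rnorm_sqr l2_coord_le.
Qed.

(** A Cauchy filter converges at each coordinate, to l. Fatou's argument: an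
estimate |a - b| <= e valid for all b far along the filter holds for every
finite partial sum, where b can be replaced by the limit l; hence a - l has
energy at most e^2. So l = a - (a - l) is square-summable, and the filter
converges to it. *)
Lemma l2_complete (F : set_system l2) : ProperFilter F -> cauchy F -> cvg F.
Proof.
move=> FF Fc.
have Fn (e : R) : 0 < e -> \forall a \near F, \forall b \near F, rnorm (a - b) <= e.
  move=> e0; have e0' : 0 < e%:C by rewrite ltcR.
  apply: filterS (nearP_dep ((cauchy_ballP F).2 Fc _ e0')) => a.
  by apply: filterS => b; rewrite -ball_normE /= -rnormE ltcR => /ltW.
have lim_coord (p : R[i] -> R) i :
    (forall z w : R[i]^o, `|p z - p w| <= rnorm (z - w)) ->
    exists l : R, (fun a : l2 => p (a i)) @ F --> l.
  move=> pl; suff /cvg_ex [l hl] : cvg ((fun a : l2 => p (a i)) @ F) by exists l.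
  apply: R_complete; apply: cauchy_exP => e e0.
  have e20 : 0 < e / 2 by rewrite divr_gt0.
  have [a ha] := filter_ex (Fn _ e20); exists (p (a i)).
  apply: filterS ha => b ab /=.
  rewrite -ball_normE /=; apply: le_lt_trans (pl _ _) _.
  apply: le_lt_trans (l2_rnorm_coord (a - b) i) _.
  by apply: le_lt_trans ab _; rewrite ltr_pdivrMr // ltr_pMr // ltr1n.
have /choice [lr hlr] : forall i, exists l : R, (fun a : l2 => complex.Re (a i)) @ F --> l.
  by move=> i; apply: lim_coord => z w; rewrite -ReB; exact: ler_Re_rnorm.
have /choice [li hli] : forall i, exists l : R, (fun a : l2 => complex.Im (a i)) @ F --> l.
  move=> i; apply: lim_coord => z w.
  by apply: le_trans (ler_Im_rnorm (z - w)); case: z w => [? ?] [? ?].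
pose l i : R[i]^o := Complex (lr i) (li i).
have partial_le (a : l2) (e : R) (X : {fset I}) : 0 <= e ->
    (\forall b \near F, rnorm (a - b) <= e) ->
    \sum_(i <- X) rnorm (a i - l i) ^+ 2 <= e ^+ 2.
  move=> e0 ab; pose s (b : l2) := \sum_(i <- X) rnorm (a i - b i) ^+ 2.
  have cs : s @ F --> \sum_(i <- X) rnorm (a i - l i) ^+ 2.
    have ct i : (fun b : l2 => rnorm (a i - b i) ^+ 2) @ F --> rnorm (a i - l i) ^+ 2.
      have cr : (fun b : l2 => complex.Re (a i) - complex.Re (b i)) @ F
          --> complex.Re (a i) - lr i by apply: cvgB; [exact: cvg_cst | exact: hlr].
      have ci : (fun b : l2 => complex.Im (a i) - complex.Im (b i)) @ F
          --> complex.Im (a i) - li i by apply: cvgB; [exact: cvg_cst | exact: hli].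
      have E (z w : R[i]) : rnorm (z - w : R[i]^o) ^+ 2 =
          (complex.Re z - complex.Re w) * (complex.Re z - complex.Re w)
          + (complex.Im z - complex.Im w) * (complex.Im z - complex.Im w).
        by case: z w => [? ?] [? ?]; rewrite rnormzE /= !expr2.
      rewrite E (_ : (fun b : l2 => _) = (fun b : l2 =>
          (complex.Re (a i) - complex.Re (b i)) * (complex.Re (a i) - complex.Re (b i))
          + (complex.Im (a i) - complex.Im (b i)) * (complex.Im (a i) - complex.Im (b i)))).
        by apply: cvgD; apply: cvgM.
      by apply/funext => b; exact: E.
    rewrite /s; elim: (X : seq I) => [|i r IH].
      by rewrite big_nil; under eq_fun do rewrite big_nil; exact: cvg_cst.
    by rewrite big_cons; under eq_fun do rewrite big_cons; exact: cvgD.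
  rewrite -(cvg_lim (@Rhausdorff R) cs); apply: limr_le.
    by apply/cvg_ex; exists (\sum_(i <- X) rnorm (a i - l i) ^+ 2).
  apply: filterS ab => b ab; rewrite /s.
  apply: (@le_trans _ _ (sqnorm (a - b))).
    apply: (@psum_ge _ _ (fun i => rnorm ((a - b) i) ^+ 2)) => [i|]; first exact: sqr_ge0.
    exact: l2_lty.
  by rewrite -l2_rnorm_sqr ler_sqr ?nnegrE ?rnorm_ge0.
have energy_le (a : l2) (e : R) : 0 <= e -> (\forall b \near F, rnorm (a - b) <= e) ->
    (energy (fun i => a i - l i : R[i]^o)%R <= (e ^+ 2)%:E)%E.
  by move=> e0 ab; apply: asum_le => X; exact: partial_le.
have [a0 ha0] : exists a0 : l2, \forall b \near F, rnorm (a0 - b) <= 1.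
  exact: filter_ex (Fn 1 ltr01).
have dsq : sqsum (fun i => a0 i - l i : R[i]^o).
  apply/sqsumP; apply: le_lt_trans (energy_le a0 1 ler01 ha0) (ltry _).
(* The family l enters l2 as the difference of two of its elements. *)
pose L : l2 := a0 - L2 dsq.
have LE i : L i = l i by rewrite -[RHS](subKr (a0 i)).
apply/cvg_ex; exists L; suff : id @ F --> L by [].
apply/cvg_rnormP => e e0.
apply: filterS (Fn e e0) => a ha.
rewrite -ler_sqr ?nnegrE ?rnorm_ge0 ?(ltW e0) // l2_rnorm_sqr.
rewrite -lee_fin psumK; last exact: l2_lty.
  have := energy_le a e (ltW e0) ha; rewrite /energy.
  by under eq_fun => i do rewrite -LE.
by move=> i; exact: sqr_ge0.
Qed.

HB.instance Definition _ := Uniform_isComplete.Build l2 l2_complete.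

Lemma l2dot_bilinear : @bilinear_for R[i] l2 l2 R[i] *%R (Num.conj \; *%R) l2dot.
Proof.
split=> [d c a b|d c a b]; first exact: l2dot_linear.
by rewrite /= l2dotC l2dot_linear rmorphD rmorphM /= -!l2dotC.
Qed.

HB.instance Definition _ := bilinear_isBilinear.Build R[i] l2 l2 R[i]
  *%R (Num.conj \; *%R) l2dot l2dot_bilinear.

Lemma l2dot_hermitian a b : l2dot a b = (-1) ^+ false * (l2dot b a)^*.
Proof. by rewrite expr0 mul1r; exact: l2dotC. Qed.

HB.instance Definition _ :=
  isHermitianSesquilinear.Build R[i] l2 false Num.conj l2dot l2dot_hermitian.

Lemma l2dot_definite a : a != 0 -> 0 < l2dot a a.
Proof.
by rewrite l2dot_sqnorm -l2_rnorm_sqr ltcR -rnorm_eq0 exprn_even_gt0.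
Qed.

HB.instance Definition _ := isDotProduct.Build R[i] l2 l2dot l2dot_definite.

Lemma l2dot_norm a : l2dot a a = `|a| ^+ 2.
Proof. by rewrite l2dot_sqnorm -l2_rnorm_sqr -rnormE rmorphXn. Qed.

HB.instance Definition _ := CompleteNormedModule_isHilbert.Build R l2 l2dot_norm.

End L2Space.

Lemma closure_rnormP (R : realType) (V : normedModType R[i]) (S : set V) (a : V) :
  closure S a <-> forall e : R, 0 < e -> exists2 s, S s & rnorm (s - a) <= e.
Proof.
split=> [Sa e e0|Sa B /nbhs_ballP [e /= e0 eB]].
  have e0' : 0 < e%:C :> R[i] by rewrite ltcR.
  have [s [Ss]] := Sa _ (nbhsx_ballx a _ e0').
  rewrite -ball_normE /= -rnormE ltcR => /ltW se; exists s => //.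
  by rewrite rnorm_distC.
have eE : e = (complex.Re e)%:C by rewrite RRe_real // gtr0_real.
have e20 : 0 < complex.Re e / 2 by rewrite divr_gt0 // -ltcR -eE.
have [s Ss sa] := Sa _ e20; exists s; split => //; apply: eB.
rewrite -ball_normE /= eE -rnormE ltcR rnorm_distC.
by apply: le_lt_trans sa _; rewrite ltr_pdivrMr // ltr_pMr ?ltr1n // -ltcR -eE.
Qed.

Lemma inner_sumr (R : realType) (H : hilbertType R) (J : Type) (r : seq J)
    (c : J -> R[i]) (f : J -> H) (u : H) :
  inner u (\sum_(j <- r) c j *: f j) = \sum_(j <- r) (c j)^* * inner u (f j).
Proof.
elim: r => [|j r IH]; first by rewrite !big_nil linear0r.
by rewrite !big_cons innerDr innerZr IH.
Qed.

Section StandardBasis.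
Variables (R : realType) (I : choiceType).

Definition basis_fun (i : I) : I -> R[i]^o := fun j => (j == i)%:R.

Lemma basis_fun_sqsum i : sqsum (basis_fun i).
Proof.
apply/sqsumP; rewrite /energy (@asum_single _ _ _ i) ?ltry ?sqr_ge0 // => j.
by rewrite /basis_fun => /negPf ->; rewrite rnorm0 expr0n.
Qed.

Definition std_basis (i : I) : l2 R I := L2 (basis_fun_sqsum i).

Lemma inner_std_basis (a : l2 R I) i : inner a (std_basis i) = a i.
Proof.
rewrite [LHS](@csum_single _ _ _ i) /= /basis_fun.
  by rewrite eqxx rmorph1 mulr1.
by move=> j /negPf ->; rewrite rmorph0 mulr0.
Qed.

Lemma std_basis_orthonormal i j :
  inner (std_basis i) (std_basis j) = (i == j)%:R.
Proof. by rewrite inner_std_basis /= /basis_fun eq_sym. Qed.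

(** If the finite set X captures the energy of a up to e^2, the truncation t of
a to X is e-close to a: <a, t> = <t, t> is the energy captured by X, so
|a - t|^2 = |a|^2 - |t|^2. *)
Lemma std_basis_dense : closure (lin_span std_basis) = [set: l2 R I].
Proof.
apply/seteqP; split => // a _; apply/closure_rnormP => e e0.
have [X hX] := psum_adherent (fun i => sqr_ge0 (rnorm (a i))) (l2_lty a) (exprn_gt0 2 e0).
pose t : l2 R I := \sum_(i <- X) a i *: std_basis i.
exists t; first by exists X, (fun i => a i).
have sumE : \sum_(i <- X) (a i)^* * (a i : R[i]) = (\sum_(i <- X) rnorm (a i) ^+ 2)%:C.
  rewrite rmorph_sum; apply: eq_bigr => i _ /=.
  by rewrite mulrC -rnormz_conj.
have inner_at : inner a t = (\sum_(i <- X) rnorm (a i) ^+ 2)%:C.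
  by rewrite inner_sumr -sumE; apply: eq_bigr => i _; rewrite inner_std_basis.
have tX i : i \in X -> t i = a i.
  move=> iX; rewrite -inner_std_basis innerC inner_sumr.
  rewrite (big_fsetD1 i) //= std_basis_orthonormal eqxx mulr1.
  rewrite big_seq big1 ?addr0 ?conjCK // => j.
  by rewrite !inE eq_sym std_basis_orthonormal => /andP[/negPf -> _]; rewrite mulr0.
have inner_tt : inner t t = (\sum_(i <- X) rnorm (a i) ^+ 2)%:C.
  rewrite inner_sumr -sumE big_seq [RHS]big_seq; apply: eq_bigr => i iX.
  by rewrite inner_std_basis tX.
rewrite rnorm_distC -ler_sqr ?nnegrE ?rnorm_ge0 ?(ltW e0) //.
rewrite sqr_rnormD rnormN innerNr ReN inner_at.
have -> : rnorm t ^+ 2 = \sum_(i <- X) rnorm (a i) ^+ 2.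
  by apply: complexI; rewrite -inner_rnorm inner_tt.
move: hX; rewrite -/(sqnorm a) -l2_rnorm_sqr /=; lra.
Qed.

Lemma std_basis_orthonormal_basis : orthonormal_basis std_basis.
Proof. by split; [exact: std_basis_orthonormal | exact: std_basis_dense]. Qed.

End StandardBasis.

(** * Parseval frames as halves of sums of two orthonormal bases *)

(** The upper frame bound is what makes the family of coefficients
square-summable. *)
Lemma analysis_operator (R : realType) (H : hilbertType R) (I : choiceType)
    (y : I -> H) (B : R) :
  (forall v, \esum_(i in [set: I]) (rnorm (inner v (y i) : R[i]^o) ^+ 2)%:E
     <= (B * rnorm v ^+ 2)%:E)%E ->
  exists T : {linear H -> l2 R I}, forall v i, T v i = inner v (y i).
Proof.
move=> yB.
have sq v : sqsum (fun i => inner v (y i) : R[i]^o).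
  by apply/sqsumP; exact: le_lt_trans (yB v) (ltry _).
have Tlin : linear (fun v => L2 (sq v)).
  by move=> c u v; apply: l2P => i; rewrite /= inner_linear.
by have [T TE] := linear_function_bundle Tlin; exists T => v i; rewrite TE.
Qed.

Lemma isometry_rnorm (R : realType) (H K : hilbertType R) (T : {linear H -> K}) :
  (forall u v, inner (T u) (T v) = inner u v) -> forall v, rnorm (T v) = rnorm v.
Proof.
move=> Tiso v; apply/eqP; rewrite -(eqrXn2 (ltn0Sn 1)) ?rnorm_ge0 //.
by apply/eqP/complexI; rewrite -!inner_rnorm Tiso.
Qed.

(** Density is transported by the involution: approximating U a by
combinations of the f_i amounts to approximating a by combinations of the U f_i. *)
Lemma orthonormal_basis_unitary (R : realType) (K : hilbertType R) (I : eqType)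
    (U : {linear K -> K}) (f : I -> K) :
  (forall a b, inner (U a) (U b) = inner a b) -> (forall a, U (U a) = a) ->
  orthonormal_basis f -> orthonormal_basis (fun i => U (f i)).
Proof.
move=> Uiso UU [fo fd]; split=> [i j|]; first by rewrite Uiso.
apply/seteqP; split => // a _; apply/closure_rnormP => e e0.
have /closure_rnormP /(_ e e0) [_ [s [c ->]] h] : closure (lin_span f) (U a) by rewrite fd.
exists (\sum_(i <- s) c i *: U (f i)); first by exists s, c.
rewrite -(isometry_rnorm Uiso) linearB /= linear_sum /=.
suff -> : \sum_(i <- s) U (c i *: U (f i)) = \sum_(i <- s) c i *: f i by [].
by apply: eq_bigr => i _; rewrite linearZ /= UU.
Qed.

Section Reflection.
Variables (R : realType) (H K : hilbertType R) (J : {linear H -> K}) (J' : {linear K -> H}).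
Hypothesis Jiso : forall u v, inner (J u) (J v) = inner u v.
Hypothesis J'adj : forall a v, inner (J' a) v = inner a (J v).

Lemma adjoint_isometryK v : J' (J v) = v.
Proof. by apply: inner_extl => w; rewrite J'adj Jiso. Qed.

(** P = J J' is the orthogonal projection onto the range of the isometry J, and
U = 2 P - 1 is the reflection through that range; it is unitary and P is the
average of 1 and U. *)
Lemma reflection_exists : exists U : {linear K -> K},
  [/\ forall a, U a = 2 *: J (J' a) - a,
      forall a b, inner (U a) (U b) = inner a b & forall a, U (U a) = a].
Proof.
have Ulin : linear (fun a => 2 *: J (J' a) - a).
  move=> c a b; rewrite (linearP J') (linearP J) scalerDr scalerA [2 * c]mulrC.
  by rewrite -scalerA opprD addrACA -scalerBr.
have [U UE] := linear_function_bundle Ulin.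
exists U; split=> // [a b|a].
  rewrite !UE innerBl !innerBr !innerZl !innerZr Jiso -J'adj.
  rewrite (innerC (J _) b) -J'adj -innerC rmorph_nat.
  ring.
have J'U : J' (U a) = J' a.
  by rewrite UE linearB linearZ /= adjoint_isometryK scaler_nat mulr2n addrK.
by rewrite UE J'U UE subKr.
Qed.

(** The range of J is the fixed space of the reflection, and the fixed space of
an isometry is closed. *)
Lemma range_isometry_closed : closed (range J).
Proof.
have [U [UE Uiso _]] := reflection_exists => a /closure_rnormP aJ.
suff Ua : U a = a.
  have two : (2 : R[i]) != 0 by rewrite pnatr_eq0.
  exists (J' a) => //; apply: (scalerI two).
  by rewrite -[LHS](subrK a) -UE Ua scaler_nat mulr2n.
apply/eqP; rewrite -subr_eq0 -rnorm_eq0 eq_le rnorm_ge0 andbT.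
apply/ler_addgt0Pl => e e0; rewrite addr0.
have e20 : 0 < e / 2 by rewrite divr_gt0.
have [_ [v _ <-] h] := aJ _ e20.
have UJ : U (J v) = J v.
  by rewrite UE adjoint_isometryK scaler_nat mulr2n addrK.
have -> : U a - a = (J v - a) - U (J v - a).
  by rewrite linearB /= UJ opprB [RHS]addrC addrA subrK.
apply: le_trans (ler_rnormD _ _) _; rewrite rnormN (isometry_rnorm Uiso); lra.
Qed.

End Reflection.

Theorem corollary2p9 (R : realType) (H : hilbertType R) (I : countType)
    (x : I -> H) (hx : is_frame x) :
  exists y : I -> H,
    [/\ is_frame y, equivalent_families x y &
      exists (K : hilbertType R) (J : {linear H -> K}) (f g : I -> K),
        [/\ closed_subspace_embedding J, orthonormal_basis f,
            orthonormal_basis g &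
            forall i : I, J (y i) = 2^-1 *: (f i + g i)]].
Proof.
have [A [B [A0 AB hAB]]] := hx.
have [C CE] := analysis_operator (fun v => (hAB v).2).
have Cn v : (rnorm (C v) ^+ 2)%:E =
    (\esum_(i in [set: I]) (rnorm (inner v (x i) : R[i]^o) ^+ 2)%:E)%E.
  rewrite l2_rnorm_sqr psumK; last exact: l2_lty.
    by apply: eq_esum => i _; rewrite CE.
  by move=> i; exact: sqr_ge0.
have CAB v : A * rnorm v ^+ 2 <= rnorm (C v) ^+ 2 <= B * rnorm v ^+ 2.
  by have [lo hi] := hAB v; apply/andP; split; rewrite -lee_fin Cn.
have B0 : 0 <= B by apply: le_trans AB; exact: ltW.
have Cb v : rnorm (C v) <= Num.sqrt B * rnorm v.
  rewrite -ler_sqr ?nnegrE ?mulr_ge0 ?rnorm_ge0 ?sqrtr_ge0 //.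
  by rewrite exprMn (sqr_sqrtr B0); case/andP: (CAB v).
have [D DE] := adjoint_exists Cb.
pose S : {linear H -> H} := D \o C.
have SE u v : inner (S u) v = inner (C u) (C v) by exact: DE.
have Ssa u v : inner (S u) v = inner u (S v) by rewrite SE [RHS]innerC SE -innerC.
have SAB v : A * rnorm v ^+ 2 <= complex.Re (inner (S v) v) <= B * rnorm v ^+ 2.
  by rewrite SE inner_rnorm; exact: CAB.
have [L [L' [Lb L'b LK L'K [Lsa LS]]]] := inverse_square_root A0 AB Ssa SAB.
pose J : {linear H -> l2 R I} := C \o L.
have JE v i : J v i = inner v (L (x i)) by rewrite /J /= CE Lsa.
have Jiso u v : inner (J u) (J v) = inner u v by rewrite -LS SE.
have Jn := isometry_rnorm Jiso.
have Jb v : rnorm (J v) <= 1 * rnorm v by rewrite Jn mul1r.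
have [J' J'E] := adjoint_exists Jb.
have J'e i : J' (std_basis R i) = L (x i).
  by apply: inner_extl => v; rewrite J'E innerC inner_std_basis JE -innerC.
have [U [UE Uiso UU]] := reflection_exists Jiso J'E.
exists (fun i => L (x i)); split.
- exists 1, 1; split=> // v.
  suff -> : (\esum_(i in [set: I]) (rnorm (inner v (L (x i)) : R[i]^o) ^+ 2)%:E)%E
      = (rnorm v ^+ 2)%:E by rewrite mul1r.
  rewrite -Jn /J /= Cn; apply: eq_esum => i _; by rewrite Lsa.
- by exists L, L'; split.
exists (l2 R I), J, (@std_basis R I), (fun i => U (std_basis R i)); split.
- by split; [exact: Jiso | exact: range_isometry_closed Jiso J'E].
- exact: std_basis_orthonormal_basis.
- exact: orthonormal_basis_unitary (std_basis_orthonormal_basis R I).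
- move=> i; rewrite UE J'e addrC subrK scalerA mulVf ?scale1r //.
Qed.
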